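(* The objective function value of a locally optimal solution produced by the alternating algorithm for the bipartite boolean quadratic programming problem (BBQP) could be arbitrarily bad and could be worse than $\mathcal{A}(Q,c,d)$. Precisely: (i) for every real $K>0$ there exist a BBQP instance $(Q,c,d)$ and a starting vector $x^0$ for which the alternating algorithm terminates with a solution $(\hat x,\hat y)$ satisfying $f(\hat x,\hat y)>0$ and $\max_{(x,y)}f(x,y)> K\, f(\hat x,\hat y)$; and (ii) there exist a BBQP instance $(Q,c,d)$ and a starting vector $x^0$ for which the alternating algorithm terminates with a solution $(\hat x,\hat y)$ satisfying $f(\hat x,\hat y)<\mathcal{A}(Q,c,d)$.
   Context: A BBQP instance is given by a real $m\times n$ matrix $Q=(q_{ij})$ and row vectors $c\in\mathbb{R}^m$, $d\in\mathbb{R}^n$; the problem is to maximize $f(x,y)=x^TQy+cx+dy$ over $x\in\{0,1\}^m$, $y\in\{0,1\}^n$. The average value of all solutions is $\mathcal{A}(Q,c,d)=2^{-(m+n)}\sum_{(x,y)\in\{0,1\}^m\times\{0,1\}^n}f(x,y)$. The alternating algorithm starts with some $x^0\in\{0,1\}^m$. With $x^0$ fixed, it computes an optimal $y^0\in\{0,1\}^n$ by setting $y^0_j=1$ if $\sum_{i=1}^m q_{ij}x^0_i+d_j>0$ and $y^0_j=0$ otherwise. With $y^0$ fixed, it computes an optimal $x^1$ by setting $x^1_i=1$ if $\sum_{j=1}^n q_{ij}y^0_j+c_i>0$ and $x^1_i=0$ otherwise. It then fixes $x=x^1$ and computes the best $y=y^1$ in the same way, and so on, alternately. It terminates when no improvement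 of the objective function value is possible by fixing either the $x$ variables or the $y$ variables (a locally optimal solution), and outputs the current solution. *)

(* Defs.v *)
From mathcomp Require Import all_boot all_order all_algebra.
From mathcomp Require Import reals.

Set Implicit Arguments.
Unset Strict Implicit.
Unset Printing Implicit Defensive.

Import Order.TTheory GRing.Theory Num.Theory.
Local Open Scope ring_scope.

(* Points of {0,1}^k are boolean column vectors; bvec embeds them in R^k. *)
Definition bvec (R : realType) (k : nat) (x : 'cV[bool]_k) : 'cV[R]_k :=
  map_mx (fun b : bool => b%:R) x.

Definition bbqp_obj (R : realType) (m n : nat)
    (Q : 'M[R]_(m, n)) (c : 'rV[R]_m) (d : 'rV[R]_n)
    (x : 'cV[bool]_m) (y : 'cV[bool]_n) : R :=
  ((bvec R x)^T *m Q *m bvec R y + c *m bvec R x + d *m bvec R y) 0 0.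

(* The default value of the iterated maximum is the objective at (0, 0), which
   is itself one of the values ranged over. *)
Definition bbqp_max (R : realType) (m n : nat)
    (Q : 'M[R]_(m, n)) (c : 'rV[R]_m) (d : 'rV[R]_n) : R :=
  \big[Num.max/bbqp_obj Q c d (const_mx false) (const_mx false)]_(
      p : 'cV[bool]_m * 'cV[bool]_n) bbqp_obj Q c d p.1 p.2.

Definition bbqp_avg (R : realType) (m n : nat)
    (Q : 'M[R]_(m, n)) (c : 'rV[R]_m) (d : 'rV[R]_n) : R :=
  2 ^- (m + n) *
    \sum_(p : 'cV[bool]_m * 'cV[bool]_n) bbqp_obj Q c d p.1 p.2.

Definition best_y (R : realType) (m n : nat)
    (Q : 'M[R]_(m, n)) (d : 'rV[R]_n) (x : 'cV[bool]_m) : 'cV[bool]_n :=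
  \col_j (0 < \sum_i Q i j * bvec R x i 0 + d 0 j).

Definition best_x (R : realType) (m n : nat)
    (Q : 'M[R]_(m, n)) (c : 'rV[R]_m) (y : 'cV[bool]_n) : 'cV[bool]_m :=
  \col_i (0 < \sum_j Q i j * bvec R y j 0 + c 0 i).

(* Current solution after k half-steps: (x^0, y^0), (x^1, y^0), (x^1, y^1),
   (x^2, y^1), and so on, ignoring the stopping test. *)
Fixpoint alt_iter (R : realType) (m n : nat)
    (Q : 'M[R]_(m, n)) (c : 'rV[R]_m) (d : 'rV[R]_n)
    (x0 : 'cV[bool]_m) (k : nat) : 'cV[bool]_m * 'cV[bool]_n :=
  if k is k'.+1 then
    let s := alt_iter Q c d x0 k' in
    if odd k' then (s.1, best_y Q d s.1) else (best_x Q c s.2, s.2)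
  else (x0, best_y Q d x0).

Definition locally_optimal (R : realType) (m n : nat)
    (Q : 'M[R]_(m, n)) (c : 'rV[R]_m) (d : 'rV[R]_n)
    (s : 'cV[bool]_m * 'cV[bool]_n) : Prop :=
  (forall y, bbqp_obj Q c d s.1 y <= bbqp_obj Q c d s.1 s.2) /\
  (forall x, bbqp_obj Q c d x s.2 <= bbqp_obj Q c d s.1 s.2).

(* The output is the first iterate passing the stopping test. *)
Definition alt_terminates_with (R : realType) (m n : nat)
    (Q : 'M[R]_(m, n)) (c : 'rV[R]_m) (d : 'rV[R]_n)
    (x0 : 'cV[bool]_m) (xh : 'cV[bool]_m) (yh : 'cV[bool]_n) : Prop :=
  exists k : nat,
    [/\ alt_iter Q c d x0 k = (xh, yh),
        locally_optimal Q c d (xh, yh) &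
        forall j : nat, (j < k)%N ->
          ~ locally_optimal Q c d (alt_iter Q c d x0 j)].

(* Main.v *)
Require Import Defs.
From mathcomp Require Import all_boot all_order all_algebra.
From mathcomp Require Import ring lra.
From mathcomp Require Import reals.

Import Order.TTheory GRing.Theory Num.Theory.
Local Open Scope ring_scope.

(** Both parts are witnessed by one family of instances with one variable on
    each side, [f(x, y) = - (M + 1) x y + M x + y].  On the four corners of the
    unit square [f] takes the values [f(0,0) = 0], [f(1,0) = M], [f(0,1) = 1]
    and [f(1,1) = 0].  The corner [(0,1)] beats its two neighbours, and the
    algorithm started at [x = 0] sits there at once; for [M > 1] the best corner
    [(1,0)] is diagonally opposite, so it is never seen when only one side is
    changed at a time ([trap_terminates]).  The ratio of the optimum to the
    output is therefore at least [M], which is unbounded ([trap_max_ge]), and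
    the average [(M + 1) / 4] exceeds the output [1] as soon as [M > 3]
    ([trap_avg]). *)

Lemma cV1P (T : Type) (x : 'cV[T]_1) : x = const_mx (x 0 0).
Proof. by apply/matrixP=> i j; rewrite mxE !ord1. Qed.

Lemma sum_cV1_bool (V : nmodType) (F : 'cV[bool]_1 -> V) :
  \sum_x F x = F (const_mx true) + F (const_mx false).
Proof.
rewrite (reindex (fun b : bool => const_mx b : 'cV[bool]_1)) ?big_bool //.
by exists (fun x : 'cV[bool]_1 => x 0 0) => x _; rewrite ?mxE -?cV1P.
Qed.

Lemma bbqp_obj11 (R : realType) (q c d : R) (a b : bool) :
  bbqp_obj (const_mx q : 'M_1) (const_mx c) (const_mx d)
    (const_mx a) (const_mx b) = q * a%:R * b%:R + c * a%:R + d * b%:R.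
Proof.
rewrite /bbqp_obj /bvec !mxE !big_ord1 !mxE big_ord1 !mxE.
by rewrite (mulrC a%:R).
Qed.

Lemma bbqp_obj_le_max (R : realType) (m n : nat) (Q : 'M[R]_(m, n))
    (c : 'rV[R]_m) (d : 'rV[R]_n) x y :
  bbqp_obj Q c d x y <= bbqp_max Q c d.
Proof. by rewrite /bbqp_max (bigD1 (x, y)) //= le_max lexx. Qed.

Section Trap.
Variables (R : realType) (M : R).

Let Q : 'M[R]_1 := const_mx (- (M + 1)).
Let c : 'rV[R]_1 := const_mx M.
Let d : 'rV[R]_1 := const_mx 1.

Lemma trap_obj01 : bbqp_obj Q c d (const_mx false) (const_mx true) = 1.
Proof. rewrite bbqp_obj11 /=; ring. Qed.

(** At [x = 0] the gain of setting [y] to 1 is [d = 1 > 0], so the first choice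
    of [y] lands on [(0,1)].  Both neighbours of this corner have value 0, so
    the stopping test already succeeds there. *)
Lemma trap_terminates :
  alt_terminates_with Q c d (const_mx false) (const_mx false) (const_mx true).
Proof.
exists 0%N; split=> //.
  congr pair; apply/matrixP=> i j.
  by rewrite !mxE big_ord1 !mxE mulr0 add0r ltr01.
split=> [y|x]; rewrite trap_obj01.
  by rewrite (cV1P _ y) bbqp_obj11; case: (y 0 0) => /=; lra.
by rewrite (cV1P _ x) bbqp_obj11; case: (x 0 0) => /=; lra.
Qed.

Lemma trap_max_ge : M <= bbqp_max Q c d.
Proof.
apply: le_trans (bbqp_obj_le_max _ _ _ _ _ _ (const_mx true) (const_mx false)).
by rewrite bbqp_obj11 /=; lra.
Qed.

Lemma trap_avg : bbqp_avg Q c d = (M + 1) / 4.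
Proof.
rewrite /bbqp_avg.
rewrite -(pair_bigA _ (fun x y => bbqp_obj Q c d x y)) /= !sum_cV1_bool.
by rewrite !bbqp_obj11 /=; field.
Qed.

End Trap.

Theorem theorem6 (R : realType) :
  (forall K : R, 0 < K ->
     exists (m n : nat) (Q : 'M[R]_(m, n)) (c : 'rV[R]_m) (d : 'rV[R]_n)
            (x0 xh : 'cV[bool]_m) (yh : 'cV[bool]_n),
       [/\ alt_terminates_with Q c d x0 xh yh,
           0 < bbqp_obj Q c d xh yh &
           K * bbqp_obj Q c d xh yh < bbqp_max Q c d])
  /\
  (exists (m n : nat) (Q : 'M[R]_(m, n)) (c : 'rV[R]_m) (d : 'rV[R]_n)
          (x0 xh : 'cV[bool]_m) (yh : 'cV[bool]_n),
     alt_terminates_with Q c d x0 xh yh /\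
     bbqp_obj Q c d xh yh < bbqp_avg Q c d).
Proof.
split=> [K _|].
  (* The strict inequality of the claim asks for a parameter above K. *)
  do 8 eexists; split; first exact: (trap_terminates R (K + 1)).
    by rewrite trap_obj01 ltr01.
  rewrite trap_obj01 mulr1; apply: lt_le_trans (trap_max_ge R (K + 1)).
  by rewrite ltrDl ltr01.
do 8 eexists; split; first exact: (trap_terminates R 4).
by rewrite trap_obj01 trap_avg; lra.
Qed.
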